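(* Let $k$ be a field, and let $f=(f_1,\ldots,f_n)\colon\mathbb{A}^n_k\to\mathbb{A}^n_k$ be a polynomial morphism with finite fibers. Let $q=(q_1,\ldots,q_n)$ be a $k$-rational point of $\mathbb{A}^n_k$. If the reduced Bézoutian $\overline{\mathrm{B\acute ez}}(f-q)$ is constant, then $|f^{-1}(q)|\leq 1$.
   Context: Write $\mathbf{x}=(x_1,\ldots,x_n)$, $\mathbf{y}=(y_1,\ldots,y_n)$. A polynomial morphism $f\colon\mathbb{A}^n_k\to\mathbb{A}^n_k$ is given by polynomials $f_1,\ldots,f_n\in k[\mathbf{x}]$; $f-q$ denotes $(f_1-q_1,\ldots,f_n-q_n)$. The (multivariate) Bézoutian of $f$ is the determinant $\mathrm{B\acute ez}(f):=\det(\Delta_{ij})\in k[\mathbf{x},\mathbf{y}]$, where $$\Delta_{ij}=\frac{f_i(y_1,\ldots,y_{j-1},x_j,\ldots,x_n)-f_i(y_1,\ldots,y_j,x_{j+1},\ldots,x_n)}{x_j-y_j}.$$ The reduced Bézoutian $\overline{\mathrm{B\acute ez}}(f)$ is the class of $\mathrm{B\acute ez}(f)$ in $k[\mathbf{x},\mathbf{y}]/(f(\mathbf{x}),f(\mathbf{y}))$, where $(f(\mathbf{x}),f(\mathbf{y}))$ is the ideal generated by $f_1(\mathbf{x}),\ldots,f_n(\mathbf{x}),f_1(\mathbf{y}),\ldots,f_n(\mathbf{y})$. Thus $\overline{\mathrm{B\acute ez}}(f-q)$ is the class of $\mathrm{B\acute ez}(f-q)$ in $k[\mathbf{x},\mathbf{y}]/(f(\mathbf{x})-q,f(\mathbf{y})-q)$.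 For a polynomial ring $R$ over $k$ and an ideal $I\subseteq R$, an element $c\in R/I$ is called constant if (i) $I$ is a proper ideal and $c\in k\subseteq R/I$, or (ii) $I$ is not proper, in which case $c=0$. The fiber $f^{-1}(q)$ is the set of points of the closed subscheme $\mathbb{V}(f-q)\subseteq\mathbb{A}^n_k$ cut out by $f_1-q_1,\ldots,f_n-q_n$. ''Finite fibers'' means that the set-theoretic fiber of $f$ over every point is finite. *)

(* Defs.v *)
From HB Require Import structures.
From mathcomp Require Import all_boot all_algebra.
From mathcomp Require Import generic_quotient ring_quotient.
From mathcomp Require Import boolp classical_sets cardinality.
From mathcomp Require Import mpoly.

Set Implicit Arguments.
Unset Strict Implicit.
Unset Printing Implicit Defensive.

Import GRing.Theory.

Local Open Scope ring_scope.
Local Open Scope classical_set_scope.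
Local Open Scope quotient_scope.

(* [idealr_closed] includes properness. *)
Definition Spec (R : comNzRingType) : set (set R) :=
  [set P | idealr_closed (mem P) /\ prime_idealr_closed (mem P)].

Definition ideal_gen_pred (R : comNzRingType) (s : seq R) : R -> bool :=
  fun g => `[< exists h : 'I_(size s) -> R, g = \sum_i h i * s`_i >].

Lemma ideal_gen_zmod_closed (R : comNzRingType) (s : seq R) :
  zmod_closed (ideal_gen_pred s).
Proof.
split=> [|u v /asboolP[a ->] /asboolP[b ->]]; apply/asboolP.
  by exists (fun=> 0); rewrite big1 // => i _; rewrite mul0r.
exists (fun i => a i - b i); rewrite -sumrB.
by apply: eq_bigr => i _; rewrite mulrBl.
Qed.

HB.instance Definition _ (R : comNzRingType) (s : seq R) :=
  GRing.isZmodClosed.Build R (ideal_gen_pred s) (ideal_gen_zmod_closed s).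

Definition ideal_gen (R : comNzRingType) (s : seq R) : zmodClosed R :=
  GRing.ZmodClosed.clone R (ideal_gen_pred s) _.

(* [{ideal_quot I}] is the additive quotient by [I]. The library makes it a
   ring only when [I] is proper, which may fail here; being constant involves
   only the classes themselves. *)
Definition is_constant (k : fieldType) (m : nat) (s : seq {mpoly k[m]})
    (c : {ideal_quot (ideal_gen s)}) : Prop :=
  (1 \notin ideal_gen s /\
     exists a : k, c = \pi_{ideal_quot (ideal_gen s)} a%:MP) \/
  (1 \in ideal_gen s /\ c = 0).

Section Morphisms.

Variables (k : fieldType) (n : nat).

(* An endomorphism of affine n-space is given by its tuple of components. *)
Implicit Types (f : n.-tuple {mpoly k[n]}) (q : n.-tuple k).

Definition mor_sub f q : n.-tuple {mpoly k[n]} :=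
  [tuple tnth f i - (tnth q i)%:MP | i < n].

(* Points are scheme points, i.e. prime ideals; f sends P to its preimage
   under the comorphism g |-> g \mPo f. *)
Definition fiber_over f (p : set {mpoly k[n]}) : set (set {mpoly k[n]}) :=
  [set P | Spec P /\ [set g | P (g \mPo f)] = p].

Definition has_finite_fibers f : Prop :=
  forall p : set {mpoly k[n]}, Spec p -> finite_set (fiber_over f p).

(* The points of the closed subscheme V(f - q). *)
Definition fiber_at f q : set (set {mpoly k[n]}) :=
  [set P | Spec P /\ forall i, P (tnth (mor_sub f q) i)].

(* In k[x, y] = {mpoly k[n + n]} the first n variables are the x_j and the
   last n are the y_j. *)
Definition xvar (j : 'I_n) : {mpoly k[n + n]} := 'X_(lshift n j).
Definition yvar (j : 'I_n) : {mpoly k[n + n]} := 'X_(rshift n j).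

Definition at_x f : n.-tuple {mpoly k[n + n]} :=
  [tuple tnth f i \mPo [tuple xvar j | j < n] | i < n].
Definition at_y f : n.-tuple {mpoly k[n + n]} :=
  [tuple tnth f i \mPo [tuple yvar j | j < n] | i < n].

(* (y_1, ..., y_j, x_(j+1), ..., x_n) *)
Definition mixed (j : nat) : n.-tuple {mpoly k[n + n]} :=
  [tuple if (l < j)%N then yvar l else xvar l | l < n].

Definition Delta_num (g : {mpoly k[n]}) (j : 'I_n) : {mpoly k[n + n]} :=
  (g \mPo mixed j) - (g \mPo mixed j.+1).

Lemma Delta_num_dvd g j :
  exists D, Delta_num g j == D * (xvar j - yvar j).
Proof.
rewrite /Delta_num; elim/mpolyind: g => [|c m g _ _ [D /eqP HD]].
  by exists 0; rewrite !comp_mpoly0 subrr mul0r.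
pose e (l : 'I_n) : {mpoly k[n + n]} := if (l < j)%N then yvar l else xvar l.
pose M := \prod_(l < n | l != j) e l ^+ m l.
have HM : ('X_[m] \mPo mixed j) - ('X_[m] \mPo mixed j.+1)
          = M * (xvar j ^+ m j - yvar j ^+ m j).
  rewrite !comp_mpolyX (bigD1 j) //= [X in _ - X](bigD1 j) //=.
  rewrite !tnth_mktuple ltnn ltnSn mulrBr [M * _]mulrC [M * _]mulrC.
  congr (_ * _ - _ * _); apply: eq_bigr => l lj; rewrite tnth_mktuple //.
  by rewrite ltnS [in LHS]leq_eqVlt (inj_eq val_inj) (negPf lj).
exists (c *: (M * (\sum_(i < m j)
          xvar j ^+ ((m j).-1 - i) * yvar j ^+ i)) + D).
rewrite !comp_mpolyD !comp_mpolyZ opprD addrACA HD -scalerBr HM subrXX.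
apply/eqP; rewrite [RHS]mulrDl -scalerAl -[in RHS]mulrA; congr (c *: (M * _) + _).
exact: mulrC.
Qed.

(* Delta_num g j / (x_j - y_j): [xchoose] picks the quotient, which is unique
   since {mpoly k[n + n]} is a domain. *)
Definition Delta (g : {mpoly k[n]}) (j : 'I_n) : {mpoly k[n + n]} :=
  xchoose (Delta_num_dvd g j).

Lemma xvarB_neq0 (j : 'I_n) : xvar j - yvar j != 0.
Proof.
rewrite subr_eq0; apply/eqP => /(congr1 (mcoeff U_(lshift n j)%MM)) /eqP.
rewrite !mcoeffXU eqxx (eq_sym (rshift n j)) eq_lrshift.
by rewrite oner_eq0.
Qed.

Lemma DeltaP g j D :
  (D == Delta g j) = (D * (xvar j - yvar j) == Delta_num g j).
Proof.
rewrite (eqP (xchooseP (Delta_num_dvd g j))).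
by rewrite (inj_eq (mulIf (xvarB_neq0 j))).
Qed.

Definition Bez f : {mpoly k[n + n]} :=
  \det (\matrix_(i < n, j < n) Delta (tnth f i) j).

Definition reduced_Bez f : {ideal_quot (ideal_gen (at_x f ++ at_y f))} :=
  \pi_{ideal_quot (ideal_gen (at_x f ++ at_y f))} (Bez f).

End Morphisms.

(* Main.v *)
(** Put F = f - q and J = (F). Since the fiber is finite, every coordinate is
    algebraic modulo J: some monic nonconstant g_i has g_i(x_i) in J. Otherwise
    a prime P of J avoids all g(x_i); as only finitely many primes contain P,
    k[x]/P is a G-domain in the sense of Kaplansky, and a finitely generated
    algebra that is a G-domain is algebraic over k.

    Write G_i = g_i(x_i) = sum_j M_ij F_j. Modulo (G(x), F(y)) one has
    Bez(G) = det M(x) Bez(F), so if Bez(F) is the constant c modulo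
    (F(x), F(y)), then Bez(G) = c det M(x), because det M F_j lies in (G) by
    Cramer. Moreover a(x) Bez(G) = a(y) Bez(G) for every a in k[x]. The product
    of the univariate residue forms of the g_i is k[y]-linear on k[x, y], kills
    (G(x)) and takes the value 1 on Bez(G), which is a product of univariate
    Bezoutians. Applying it to a(y) Bez(G) = c a(x) det M(x) yields
    a = constant modulo J. So k[x]/J is a quotient of k and has at most one
    prime. *)

Require Import Defs.
From HB Require Import structures.
From mathcomp Require Import all_boot all_algebra.
From mathcomp Require Import generic_quotient ring_quotient.
From mathcomp Require Import boolp classical_sets cardinality.
From mathcomp Require Import mpoly ssrcomplements zify.

Set Implicit Arguments.
Unset Strict Implicit.
Unset Printing Implicit Defensive.

Import GRing.Theory.

Local Open Scope ring_scope.
Local Open Scope classical_set_scope.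
Local Open Scope quotient_scope.

(** * Ideals, primes and residue fields *)

(** Unlike [idealr_closed], this admits the whole ring: the ideal of an empty fiber is improper. *)
Definition is_ideal (R : comNzRingType) (I : set R) : Prop :=
  I 0 /\ forall a u v, I u -> I v -> I (a * u + v).

Section Ideals.

Variables (R : comNzRingType) (I : set R).
Hypothesis idI : is_ideal I.

Lemma ideal0 : I 0. Proof. by case: idI. Qed.

Lemma idealD u v : I u -> I v -> I (u + v).
Proof. by move=> Iu Iv; rewrite -[u]mul1r; apply: idI.2. Qed.

Lemma ideal_mull a u : I u -> I (a * u).
Proof.
by move=> Iu; rewrite -[_ * _]addr0; apply: idI.2 => //; apply: ideal0.
Qed.

Lemma ideal_mulr u a : I u -> I (u * a).
Proof. by rewrite mulrC; apply: ideal_mull. Qed.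

Lemma idealN u : I u -> I (- u).
Proof. by rewrite -mulN1r; apply: ideal_mull. Qed.

Lemma idealB u v : I u -> I v -> I (u - v).
Proof. by move=> Iu /idealN; apply: idealD. Qed.

Lemma ideal_sum (J : Type) (r : seq J) (P : pred J) (E : J -> R) :
  (forall i, P i -> I (E i)) -> I (\sum_(i <- r | P i) E i).
Proof. exact: (big_ind I ideal0 idealD). Qed.

Lemma idealB_trans u v w : I (u - v) -> I (v - w) -> I (u - w).
Proof. by move=> Iuv /(idealD Iuv); rewrite addrA subrK. Qed.

Lemma idealB_sym u v : I (u - v) -> I (v - u).
Proof. by move=> /idealN; rewrite opprB. Qed.

Lemma idealBM a b c d : I (a - b) -> I (c - d) -> I (a * c - b * d).
Proof.
move=> Iab Icd; have -> : a * c - b * d = (a - b) * c + b * (c - d).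
  by rewrite mulrBl mulrBr addrA subrK.
by apply: idealD; [apply: ideal_mulr | apply: ideal_mull].
Qed.

End Ideals.

Lemma ideal_gen_ideal (R : comNzRingType) (s : seq R) :
  is_ideal [set g | g \in ideal_gen s].
Proof.
split=> [|a u v /asboolP[g ->] /asboolP[h ->]]; first exact: rpred0.
apply/asboolP; exists (fun i => a * g i + h i).
rewrite mulr_sumr -big_split /=; apply: eq_bigr => i _.
by rewrite mulrDl mulrA.
Qed.

Lemma ideal_gen_mem (R : comNzRingType) (s : seq R) g :
  g \in s -> g \in ideal_gen s.
Proof.
move=> gs; apply/asboolP.
have lt_i : (index g s < size s)%N by rewrite index_mem.
exists (fun i => (i == Ordinal lt_i)%:R).
rewrite (bigD1 (Ordinal lt_i)) //= eqxx mul1r nth_index // big1 ?addr0 //.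
by move=> i /negPf ->; rewrite mul0r.
Qed.

Lemma ideal_gen_min (R : comNzRingType) (s : seq R) (I : set R) :
  is_ideal I -> (forall g, g \in s -> I g) ->
  forall g, g \in ideal_gen s -> I g.
Proof.
move=> idI sI g /asboolP[h ->]; apply: ideal_sum => // i _.
by apply: ideal_mull => //; apply/sI/mem_nth.
Qed.

Lemma SpecP (R : comNzRingType) (P : set R) :
  Spec P <-> [/\ is_ideal P, ~ P 1 & forall u v, P (u * v) -> P u \/ P v].
Proof.
have memP x : (x \in mem P) = (x \in P) by [].
split=> [[[P0 P1 PM] Pprime]|[[P0 PM] P1 Pprime]]; split.
- by split=> [|a u v Pu Pv]; [|have := PM a u v]; rewrite ?memP !inE in P0 *;
    do ?[exact]; move/(_ Pu Pv).
- by move=> H; move: P1; rewrite memP => /negP; rewrite inE.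
- move=> u v Puv; have := Pprime u v; rewrite !memP in_setE => /(_ Puv).
  by case/orP; rewrite in_setE; [left | right].
- split; rewrite ?memP ?in_setE //; first by apply/negP; rewrite in_setE.
  by move=> a u v; rewrite !memP !in_setE; apply: PM.
- move=> u v; rewrite !memP in_setE => /Pprime[] H; apply/orP; [left|right];
  by rewrite in_setE.
Qed.

Lemma is_ideal_add_mul (R : comNzRingType) (I : set R) (u : R) :
  is_ideal I -> is_ideal [set m + a * u | m in I & a in [set: R]].
Proof.
move=> idI; split=> [|c _ _ [m Im [a _ <-]] [m' Im' [a' _ <-]]].
  by exists 0; [exact: ideal0 | exists 0 => //; rewrite mul0r addr0].
exists (c * m + m'); first exact: idI.2.
exists (c * a + a') => //; rewrite mulrDr mulrDl -!addrA mulrA.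
by congr (_ + _); rewrite addrCA.
Qed.

(** Krull's argument: an ideal that is maximal among those containing [I] and disjoint from the
    multiplicative set [S] is prime. *)
Lemma exists_prime_avoiding (R : comNzRingType) (I S : set R) :
  is_ideal I -> S 1 -> (forall u v, S u -> S v -> S (u * v)) ->
  (forall u, I u -> ~ S u) ->
  exists P, [/\ Spec P, I `<=` P & forall u, P u -> ~ S u].
Proof.
move=> idI S1 SM IS.
pose good (X : set R) := is_ideal X /\ forall u, X u -> ~ S u.
(* Zorn's lemma is applied to the sets whose union with [I] is good; this form also covers the empty
   chain, whose union is empty. *)
have [F Fgood Ftot|A [[idA AS] maxA]] :=
    @Zorn_bigcup _ [set X | good (X `|` I)].
  have step u v :
      (\bigcup_(X in F) X `|` I) u -> (\bigcup_(X in F) X `|` I) v ->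
      exists Y, [/\ good Y, Y `<=` \bigcup_(X in F) X `|` I, Y u & Y v].
    move=> [[X FX Xu]|Iu] [[Y FY Yv]|Iv].
    - have [XY|YX] := Ftot _ _ FX FY.
        exists (Y `|` I); split; [exact: Fgood| |left; exact: XY|by left].
        by apply: setSU; apply: bigcup_sup.
      exists (X `|` I); split; [exact: Fgood| |by left|left; exact: YX].
      by apply: setSU; apply: bigcup_sup.
    - exists (X `|` I); split; [exact: Fgood| |by left|by right].
      by apply: setSU; apply: bigcup_sup.
    - exists (Y `|` I); split; [exact: Fgood| |by right|by left].
      by apply: setSU; apply: bigcup_sup.
    - by exists I; split.
  split=> [|u uF]; last first.
    by have [Y [[_ YS] _ Yu _]] := step u u uF uF; apply: YS.
  split; first by right; apply: ideal0.
  move=> a u v uF vF; have [Y [[idY _] YF Yu Yv]] := step u v uF vF.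
  by apply: YF; apply: idY.2.
set P := A `|` I in idA AS.
exists P; split=> //; last by right.
have big u : ~ P u -> exists m a, P m /\ S (m + a * u).
  move=> Pu; apply: contrapT => noS.
  pose B := [set m + a * u | m in P & a in [set: R]].
  have PB : P `<=` B.
    by move=> m Pm; exists m => //; exists 0; rewrite // mul0r addr0.
  apply: (maxA B).
    rewrite properEneq; split; last by move=> x Ax; apply: PB; left.
    apply/eqP => AB; apply: Pu; left; rewrite AB.
    exists 0; first exact: ideal0.
    by exists 1; rewrite // mul1r add0r.
  rewrite /= setUidl; last by move=> x Ix; apply: PB; right.
  split; first exact: is_ideal_add_mul.
  by move=> _ [m Pm [a _ <-]] Sma; apply: noS; exists m, a.
apply/SpecP; split=> // [/AS|u v Puv]; first exact.
(* The product of [m + a * u] and [m' + a' * v] lies in [S], and also in [P] because [u * v]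
   does. *)
apply: contrapT => /not_orP[/big[m [a [Pm Sma]]] /big[m' [a' [Pm' Sma']]]].
apply: AS (SM _ _ Sma Sma').
rewrite mulrDl; apply: idealD => //; first exact: ideal_mulr.
rewrite mulrDr; apply: idealD => //; first exact: ideal_mull.
by rewrite mulrACA; apply: ideal_mull.
Qed.

Section ResidueField.

Variables (R : comNzRingType) (P : set R).
Hypothesis specP : Spec P.

Definition prime_pred of Spec P : R -> bool := fun x => x \in P.

HB.instance Definition _ := isIdealr.Build R (prime_pred specP) specP.1.
HB.instance Definition _ :=
  isPrimeIdealrClosed.Build R (prime_pred specP) specP.2.

Definition prime_ideal : prime_idealr R :=
  PrimeIdealr.clone R (prime_pred specP) _.

Definition domain_quot := {ideal_quot prime_ideal}.

HB.instance Definition _ := GRing.ComNzRing.on domain_quot.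

(** Units and inverses, chosen classically, make R/P an integral domain whose field of fractions can
    be formed. *)
Definition domain_quot_unit : pred domain_quot :=
  fun x => `[< exists y, y * x = 1 >].

Definition domain_quot_inv (x : domain_quot) : domain_quot :=
  if pselect (exists y, y * x = 1) is left ex then projT1 (cid ex) else x.

Lemma domain_quot_mulVr :
  {in domain_quot_unit, left_inverse 1 domain_quot_inv *%R}.
Proof.
move=> x /asboolP ex; rewrite /domain_quot_inv.
by case: pselect => // ex'; case: (cid ex').
Qed.

Lemma domain_quot_unitPl x y : y * x = 1 -> domain_quot_unit x.
Proof. by move=> yx1; apply/asboolP; exists y. Qed.

Lemma domain_quot_inv_out : {in [predC domain_quot_unit], domain_quot_inv =1 id}.
Proof.
move=> x; rewrite inE /= => /asboolPn ex; rewrite /domain_quot_inv.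
by case: pselect.
Qed.

HB.instance Definition _ := GRing.ComNzRing_hasMulInverse.Build domain_quot
  domain_quot_mulVr domain_quot_unitPl domain_quot_inv_out.

HB.instance Definition _ := GRing.ComUnitRing_isIntegral.Build domain_quot
  (@Quotient.rquot_IdomainAxiom R prime_ideal).

Definition residue_map : {rmorphism R -> {fraction domain_quot}} :=
  (@FracField.tofrac domain_quot \o \pi_domain_quot : {rmorphism R -> _}).

Lemma residue_map_eq0 x : residue_map x = 0 <-> P x.
Proof.
have pi_eq0 : (\pi_domain_quot x == 0) = (x \in prime_ideal).
  by rewrite -{2}[x]subr0 Quotient.idealrBE [in RHS]rmorph0.
rewrite -[P x]in_setE -[x \in P]/(x \in prime_ideal) -pi_eq0.
rewrite -(tofrac_eq0 (\pi_domain_quot x : domain_quot)).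
by split=> [/eqP|/eqP].
Qed.

End ResidueField.

(** * G-domains *)

(* Kaplansky's G-domains: inverting a single element of X yields a field. *)
Definition is_Gdomain (F : fieldType) (X : set F) : Prop :=
  exists h, [/\ X h, h != 0 &
    forall u, X u -> u != 0 -> exists m v, X v /\ h ^+ m = u * v].

(** The range is the subring phi(R)[b]. Subrings of [F] are handled throughout as ranges of ring
    morphisms. *)
Definition poly_ev (R : comNzRingType) (F : fieldType) (phi : {rmorphism R -> F})
    (b : F) : {rmorphism {poly R} -> F} :=
  horner_morph (fun x => mulrC b (phi x)).

Section PolyEv.

Variables (R : comNzRingType) (F : fieldType) (phi : {rmorphism R -> F}) (b : F).

Lemma poly_evE p : poly_ev phi b p = (map_poly phi p).[b].
Proof. by []. Qed.

Lemma poly_evC c : poly_ev phi b c%:P = phi c.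
Proof. exact: horner_morphC. Qed.

Lemma poly_evX : poly_ev phi b 'X = b.
Proof. exact: horner_morphX. Qed.

End PolyEv.

(** If [b] were transcendental, phi(R)[b] would be a polynomial ring. With h = P(b), the polynomial
    1 + XP would then divide a power of P while being coprime to P and nonconstant. *)
Lemma Gdomain_algebraic (R : comNzRingType) (F : fieldType)
    (phi : {rmorphism R -> F}) (b : F) :
  is_Gdomain (range (poly_ev phi b)) ->
  exists2 p, map_poly phi p != 0 & root (map_poly phi p) b.
Proof.
move=> [_ [[p _ <-]]]; rewrite poly_evE => h0 hG; apply: contrapT => trans.
have inj q : (map_poly phi q).[b] = 0 -> map_poly phi q = 0.
  move=> q0; apply: contrapT => /eqP qn0; apply: trans; exists q => //.
  exact/rootP.
set P := map_poly phi p in h0 hG.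
have P0 : P != 0 by apply: contraNneq h0 => ->; rewrite horner0.
have sizeU : (1 < size ('X * P + 1)%R)%N.
  by rewrite mulrC size_MXaddC (negPf P0) /= ltnS size_poly_gt0.
have mapU : map_poly phi ('X * p + 1) = 'X * P + 1.
  by rewrite rmorphD rmorph1 rmorphM /= map_polyX.
have [||m [_ [[q _ <-]]]] := hG ('X * P + 1).[b].
- by exists ('X * p + 1); rewrite // poly_evE mapU.
- apply: contraTneq sizeU; rewrite -mapU => /inj ->; by rewrite size_poly0.
rewrite poly_evE => divb.
have : map_poly phi (p ^+ m - ('X * p + 1) * q) = 0.
  apply: inj; rewrite rmorphB rmorphM rmorphXn /= mapU.
  by rewrite hornerD hornerN horner_exp divb hornerM subrr.
rewrite rmorphB rmorphM rmorphXn /= mapU -/P => /eqP.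
rewrite subr_eq0 => /eqP divP.
have cop : coprimep ('X * P + 1) P.
  apply/Bezout_coprimepP; exists (1, - 'X) => /=.
  by rewrite mul1r mulNr addrC addKr eqpxx.
have : coprimep ('X * P + 1) (P ^+ m) by apply: coprimep_expr.
rewrite divP coprimepMr coprimepp => /andP[/eqP size1 _].
by rewrite size1 in sizeU.
Qed.

(** * Integrality over the range of a morphism *)

Section Integrality.

Variables (A : comNzRingType) (F : fieldType) (psi : {rmorphism A -> F}).

Lemma range_add x y : range psi x -> range psi y -> range psi (x + y).
Proof. by move=> [a _ <-] [b _ <-]; exists (a + b); rewrite ?rmorphD. Qed.

Lemma range_opp x : range psi x -> range psi (- x).
Proof. by move=> [a _ <-]; exists (- a); rewrite ?rmorphN. Qed.

Lemma range_mul x y : range psi x -> range psi y -> range psi (x * y).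
Proof. by move=> [a _ <-] [b _ <-]; exists (a * b); rewrite ?rmorphM. Qed.

Lemma range_exp x m : range psi x -> range psi (x ^+ m).
Proof. by move=> [a _ <-]; exists (a ^+ m); rewrite ?rmorphXn. Qed.

Lemma range_sum (J : Type) (r : seq J) (P : pred J) (E : J -> F) :
  (forall i, P i -> range psi (E i)) -> range psi (\sum_(i <- r | P i) E i).
Proof.
move=> rE; apply: (big_ind (range psi)) => //; last exact: range_add.
by exists 0; rewrite ?rmorph0.
Qed.

Lemma integral_range x : range psi x -> integralOver psi x.
Proof. by move=> [a _ <-]; apply: integral_id. Qed.

Lemma integral_root_range (p : {poly F}) u :
  p \is monic -> root p u -> (forall i, range psi p`_i) -> integralOver psi u.
Proof.
move=> p_mon pu rp; apply: integral_root_monic p_mon pu _.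
by apply/integral_poly => i; apply: integral_range.
Qed.

Lemma integral_horner_range (p : {poly F}) u :
  (forall i, range psi p`_i) -> integralOver psi u -> integralOver psi p.[u].
Proof.
move=> rp; apply: integral_horner.
by apply/integral_poly => i; apply: integral_range.
Qed.

Lemma integral_exp x m : integralOver psi x -> integralOver psi (x ^+ m).
Proof.
move=> int_x; elim: m => [|m IHm]; first by rewrite expr0; apply: integral1.
by rewrite exprS; apply: integral_mul.
Qed.

(** Multiplying a monic equation of degree d for 1/u by u^(d-1) writes 1/u as a polynomial in u. *)
Lemma integral_inv_range (u : F) :
  u != 0 -> range psi u -> integralOver psi u^-1 -> range psi u^-1.
Proof.
move=> u0 ru [q q_mon /rootP]; set Q := map_poly psi q => Q0.
have Q_mon : Q \is monic by apply: monic_map.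
have rQ i : range psi Q`_i by exists q`_i; rewrite ?coef_map.
case: (posnP (size Q).-1) => [s0|]; last set d := _.-1 => d0.
  have := Q0; rewrite (@size1_polyC _ Q) ?hornerC; last first.
    by rewrite (leq_trans (leqSpred _)) ?s0.
  by move: (monicP Q_mon); rewrite lead_coefE s0 => -> /eqP; rewrite oner_eq0.
have sQ : size Q = d.+1 by rewrite prednK // size_poly_gt0 monic_neq0.
move: Q0; rewrite horner_coef sQ big_ord_recr /=.
have -> : Q`_d = 1 by rewrite -[RHS](monicP Q_mon) lead_coefE.
rewrite mul1r => /eqP; rewrite addrC addr_eq0 => /eqP.
move=> /(congr1 ( *%R (u ^+ d.-1))).
rewrite -{2}(prednK d0) exprS exprVn mulrCA divff ?expf_neq0 // mulr1 => ->.
rewrite -sumrN mulr_sumr.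
apply: range_sum => i _.
have le_i : (i <= d.-1)%N by rewrite -ltnS prednK.
rewrite mulrN mulrCA -{1}(subnK le_i) exprD exprVn mulfK ?expf_neq0 //.
by apply: range_opp; apply: range_mul => //; apply: range_exp.
Qed.

End Integrality.

(** After removal of the power of X dividing [p], the constant term p_i is nonzero, and p(h) = 0
    reads p_i = h s(h). Thus 1/h is integral wherever h is and 1/p_i is available. *)
Lemma root_inv_horner (F : fieldType) (h : F) (p : {poly F}) :
  h != 0 -> p != 0 -> root p h ->
  exists i (s : {poly F}), [/\ p`_i != 0, h^-1 = (p`_i)^-1 * s.[h] &
    forall j, s`_j = - p`_(i + j).+1].
Proof.
move=> h0; elim/poly_ind: p => [|p c IHp]; first by rewrite eqxx.
have coefS j : (p * 'X + c%:P)`_j.+1 = p`_j by rewrite coefD coefMX coefC addr0.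
move=> pc0 /rootP; rewrite !hornerE.
have [c0|c0 /eqP] := eqVneq c 0; first subst c.
  move=> /eqP; rewrite addr0 mulf_eq0 (negPf h0) orbF => ph.
  have p0 : p != 0 by apply: contraNneq pc0 => ->; rewrite mul0r addr0.
  have [i [s [pi0 hV sE]]] := IHp p0 ph.
  by exists i.+1, s; rewrite coefS; split=> // j; rewrite addSn coefS.
rewrite addrC addr_eq0 => /eqP ph.
exists 0, (- p); rewrite coefD coefMX coefC add0r; split=> // [|j].
  by apply: (mulIf h0); rewrite mulVf // hornerN -mulrA mulNr -ph mulVf.
by rewrite coefN coefS.
Qed.

(** * Descent of the G-domain property along a generator *)

Section GdomainDescent.

Variables (R : comNzRingType) (F : fieldType) (phi : {rmorphism R -> F}).

Lemma range_poly_evS b x : range phi x -> range (poly_ev phi b) x.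
Proof. by move=> [r _ <-]; exists r%:P; rewrite // poly_evC. Qed.

Lemma range_poly_ev_gen b : range (poly_ev phi b) b.
Proof. by exists 'X; rewrite // poly_evX. Qed.

Lemma range_poly_ev_min b (A : comNzRingType) (psi : {rmorphism A -> F}) :
  range phi `<=` range psi -> range psi b ->
  range (poly_ev phi b) `<=` range psi.
Proof.
move=> phipsi psib _ [p _ <-]; rewrite poly_evE horner_coef.
apply: range_sum => i _; apply: range_mul; last exact: range_exp.
by rewrite coef_map; apply: phipsi; exists p`_i.
Qed.

Lemma range_poly_ev_inv d x : range (poly_ev phi d^-1) x ->
  range phi d -> d != 0 -> exists m, range phi (d ^+ m * x).
Proof.
(* The size of [p] exceeds every power of 1/d that occurs, so this exponent clears all
   denominators. *)
move=> [p _ <-] rd d0; exists (size p); rewrite poly_evE.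
rewrite (@horner_coef_wide _ (size p)) ?size_poly // mulr_sumr.
apply: range_sum => i _; rewrite coef_map mulrCA.
apply: range_mul; first by exists p`_i.
rewrite -{1}(subnK (ltnW (ltn_ord i))) exprD exprVn mulfK ?expf_neq0 //.
exact: range_exp.
Qed.

(* b and the inverse of h become integral over R once a single nonzero d is
   inverted; then so is the inverse of any u in R, since u divides a power
   of h. *)
Lemma Gdomain_descent b :
  is_Gdomain (range (poly_ev phi b)) -> is_Gdomain (range phi).
Proof.
move=> Gb; have [p p0 pb] := Gdomain_algebraic Gb.
have [h [rh h0 hG]] := Gb.
(* Dividing by the leading coefficient makes the equation of [b] monic over phi(R)[1/c]. *)
pose c := lead_coef (map_poly phi p).
have c0 : c != 0 by rewrite lead_coef_eq0.
have rc : range phi c.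
  by rewrite /c lead_coefE coef_map; exists p`_(size (map_poly phi p)).-1.
pose E := poly_ev phi c^-1.
have int_b : integralOver E b.
  apply: (@integral_root_range _ _ _ (c^-1 *: map_poly phi p)).
  - by rewrite monicE lead_coefZ mulVf.
  - by rewrite rootZ // invr_eq0.
  move=> i; rewrite coefZ; apply: range_mul; first exact: range_poly_ev_gen.
  by apply: range_poly_evS; rewrite coef_map; exists p`_i.
have int_h : integralOver E h.
  have [q _ <-] := rh; rewrite poly_evE; apply: integral_horner_range => // i.
  by apply: range_poly_evS; rewrite coef_map; exists q`_i.
have [q q_mon qh] := int_h.
have rq i : range E (map_poly E q)`_i by rewrite coef_map; exists q`_i.
have [i [s [e0 hV sE]]] := root_inv_horner h0 (monic_neq0 (monic_map E q_mon)) qh.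
set e := (map_poly E q)`_i in e0 hV.
(* The coefficient [e] is only in phi(R)[1/c], but [t = c ^+ m * e] is in phi(R); inverting
   [d = c * t] inverts both [c] and [e]. *)
have [m rt] := range_poly_ev_inv (rq i) rc c0; rewrite -/e in rt.
set t := c ^+ m * e in rt.
have t0 : t != 0 by rewrite mulf_neq0 ?expf_neq0.
pose d := c * t.
have d0 : d != 0 by rewrite mulf_neq0.
have rd : range phi d by apply: range_mul.
pose psi := poly_ev phi d^-1.
have phi_psi : range phi `<=` range psi by move=> x; apply: range_poly_evS.
have psi_d : range psi d^-1 by apply: range_poly_ev_gen.
have psi_c : range psi c^-1.
  have -> : c^-1 = d^-1 * t by rewrite invfM mulfVK.
  by apply: range_mul => //; apply: phi_psi.
have psi_e : range psi e^-1.
  have -> : e^-1 = d^-1 * (c * c ^+ m).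
    by apply: (mulIf e0); rewrite mulVf // -!mulrA -/t mulVf.
  apply: range_mul => //; apply: range_mul; first exact: phi_psi.
  by apply: range_exp; apply: phi_psi.
have E_psi : range E `<=` range psi by apply: range_poly_ev_min.
have int_h_psi : integralOver psi h.
  apply: (@integral_root_range _ _ _ (map_poly E q)) => //; first exact: monic_map.
  by move=> j; apply: E_psi.
have int_hV : integralOver psi h^-1.
  rewrite hV; apply: integral_mul; first exact: integral_range.
  apply: integral_horner_range => // j; rewrite sE.
  by apply: range_opp; apply: E_psi.
have int_b_psi : integralOver psi b.
  apply: (@integral_root_range _ _ _ (c^-1 *: map_poly phi p)).
  - by rewrite monicE lead_coefZ mulVf.
  - by rewrite rootZ // invr_eq0.
  move=> j; rewrite coefZ; apply: range_mul => //.
  by apply: phi_psi; rewrite coef_map; exists p`_j.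
(* Since 1/u = v / h^l is integral over phi(R)[1/d], it belongs to that ring; clearing denominators
   shows that [u] divides a power of [d]. *)
exists d; split=> // u ru u0.
have [l [v [rv huv]]] := hG u (range_poly_evS b ru) u0.
have int_uV : integralOver psi u^-1.
  have -> : u^-1 = v * (h^-1) ^+ l.
    by rewrite exprVn huv invfM mulrCA divff ?mulr1 //;
       apply: contra_eq_neq huv => ->; rewrite mulr0 expf_neq0.
  apply: integral_mul; last exact: integral_exp.
  have [w _ <-] := rv; rewrite poly_evE; apply: integral_horner_range => // j.
  by apply: phi_psi; rewrite coef_map; exists w`_j.
have psi_uV := integral_inv_range u0 (phi_psi _ ru) int_uV.
have [m' rm'] := range_poly_ev_inv psi_uV rd d0.
by exists m', (d ^+ m' * u^-1); split=> //; rewrite mulrC mulfVK.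
Qed.

End GdomainDescent.

(** Adjoins the elements of [s] one by one. The source is an iterated polynomial ring whose type
    depends on [s], hence the existential; the last clause says that the range is the smallest
    possible. *)
Lemma poly_ev_iter (R : comNzRingType) (F : fieldType) (phi : {rmorphism R -> F})
    (s : seq F) :
  exists (A : comNzRingType) (psi : {rmorphism A -> F}),
  [/\ range phi `<=` range psi, {in s, forall b, range psi b},
      is_Gdomain (range psi) -> is_Gdomain (range phi) &
      forall (B : comNzRingType) (chi : {rmorphism B -> F}),
        range phi `<=` range chi -> {in s, forall b, range chi b} ->
        range psi `<=` range chi].
Proof.
elim: s => [|b s [A [psi [phipsi spsi Gpsi minpsi]]]].
  by exists R, phi; split=> // b; rewrite in_nil.
exists {poly A}, (poly_ev psi b); split.
- by move=> x /phipsi; apply: range_poly_evS.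
- move=> x; rewrite inE => /predU1P[->|/spsi]; first exact: range_poly_ev_gen.
  exact: range_poly_evS.
- by move=> /Gdomain_descent.
move=> B chi phichi schi; apply: range_poly_ev_min; last exact/schi/mem_head.
by apply: minpsi => // x xs; apply: schi; rewrite inE xs orbT.
Qed.

(** * From finitely many primes to algebraic coordinates *)

(** Descent through the other coordinates leaves k[chi 'X_i] as a G-domain, so that [chi 'X_i] is
    algebraic over [k]. *)
Lemma Gdomain_mpoly_algebraic (k : fieldType) (n : nat) (F : fieldType)
    (chi : {rmorphism {mpoly k[n]} -> F}) (i : 'I_n) :
  is_Gdomain (range chi) -> exists2 g : {poly k},
    g \is monic & chi (map_poly (@mpolyC n k) g).['X_i] = 0.
Proof.
move=> Gchi; pose iota : {rmorphism k -> F} := chi \o @mpolyC n k.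
have rX j : range chi (chi 'X_j) by exists 'X_j.
have iotachi : range iota `<=` range chi by move=> _ [c _ <-]; exists c%:MP.
(* [chi 'X_i] is adjoined to [k] first, so that descent stops there; its second occurrence in the
   list is harmless. *)
have [A [psi [evpsi spsi Gpsi minpsi]]] :=
  poly_ev_iter (poly_ev iota (chi 'X_i)) [seq chi 'X_j | j : 'I_n].
have psi_chi : range psi = range chi.
  rewrite eqEsubset; split.
    apply: minpsi; first exact: range_poly_ev_min.
    by move=> _ /mapP[j _ ->].
  move=> _ [p _ <-]; elim/mpolyind: p => [|c m p _ _ IHp].
    by rewrite rmorph0; exists 0; rewrite ?rmorph0.
  rewrite rmorphD; apply: range_add => //.
  rewrite -mul_mpolyC rmorphM; apply: range_mul.
    by apply: evpsi; apply: range_poly_evS; exists c.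
  rewrite mpolyXE_id rmorph_prod; apply: (big_ind (range psi)).
  - by exists 1; rewrite ?rmorph1.
  - exact: range_mul.
  move=> j _; rewrite rmorphXn; apply: range_exp; apply: spsi.
  by apply: map_f; rewrite mem_enum.
have [g g0 /rootP gX] :
    exists2 g, map_poly iota g != 0 & root (map_poly iota g) (chi 'X_i).
  by apply: Gdomain_algebraic; apply: Gpsi; rewrite psi_chi.
rewrite map_poly_eq0 in g0.
have lg0 : lead_coef g != 0 by rewrite lead_coef_eq0.
exists ((lead_coef g)^-1 *: g); first by rewrite monicE lead_coefZ mulVf.
rewrite -horner_map -map_poly_comp -[chi \o _]/(iota : _ -> _).
by rewrite map_polyZ hornerZ gX mulr0.
Qed.

(** Take the product of one element of each [Q] outside [P]; it stays outside because [P] is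
    prime. *)
Lemma exists_mem_all_but (R : comNzRingType) (P : set R) (s : seq (set R)) :
  Spec P -> (forall Q, Q \in s -> is_ideal Q /\ exists2 x, Q x & ~ P x) ->
  exists2 h, ~ P h & forall Q, Q \in s -> Q h.
Proof.
move=> /SpecP[_ P1 Pprime]; elim: s => [_|Q s IHs sP]; first by exists 1.
have [|h Ph sh] := IHs; first by move=> Q' Q's; apply: sP; rewrite inE Q's orbT.
have [idQ [x Qx Px]] := sP Q (mem_head _ _).
exists (x * h); first by case/Pprime.
move=> Q'; rewrite inE => /predU1P[->|Q's]; first exact: ideal_mulr.
have [idQ' _] := sP Q' (mem_behead (s := Q :: s) Q's).
exact: ideal_mull (sh _ Q's).
Qed.

(** Choose [h] outside [P] but in every prime strictly above [P]. If [p] is not in [P] and no power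
    of [h] is in P + (p), some prime above P + (p) avoids the powers of [h]; yet it lies strictly
    above [P], so it contains [h]. *)
Lemma finite_primes_Gdomain (R : comNzRingType) (P : set R) (specP : Spec P) :
  finite_set [set Q | Spec Q /\ P `<=` Q] ->
  is_Gdomain (range (residue_map specP)).
Proof.
have [idP _ _] := (SpecP P).1 specP.
move=> finP; have /finite_seqP[s sE] : finite_set [set Q | Spec Q /\ P `<` Q].
  by apply: sub_finite_set finP => Q [specQ /properW].
have [|h Ph sh] := @exists_mem_all_but R P s specP.
  move=> Q Qs; have : [set` s] Q by []; rewrite -sE => -[specQ [PQ QP]].
  have [idQ _ _] := (SpecP Q).1 specQ; split=> //.
  apply: contrapT => noQ; apply: QP => x Qx; apply: contrapT => Px.
  by apply: noQ; exists x.
exists (residue_map specP h); split; first by exists h.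
  by apply/eqP => /residue_map_eq0.
move=> _ [p _ <-] /eqP p0; apply: contrapT => noV.
have [||||Q [specQ pQ Qh]] := @exists_prime_avoiding R
    [set m + a * p | m in P & a in [set: R]] (range (GRing.exp h)).
- exact: is_ideal_add_mul.
- by exists 0; rewrite ?expr0.
- by move=> _ _ [i _ <-] [j _ <-]; exists (i + j)%N; rewrite ?exprD.
- move=> _ [m Pm [a _ <-]] [l _ hl]; apply: noV.
  exists l, (residue_map specP a); split; first by exists a.
  rewrite -rmorphXn hl rmorphD rmorphM mulrC.
  by rewrite ((residue_map_eq0 specP m).2 Pm) add0r.
have PQ : P `<=` Q.
  by move=> m Pm; apply: pQ; exists m => //; exists 0; rewrite ?mul0r ?addr0.
apply: (Qh h); last by exists 1%N; rewrite ?expr1.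
apply: sh; have : [set` s] Q; last by [].
rewrite -sE; split=> //; split=> // QP; apply: p0; apply/residue_map_eq0.
apply: QP; apply: pQ; exists 0; first exact: ideal0.
by exists 1; rewrite // mul1r add0r.
Qed.

Lemma finite_primes_elimination (k : fieldType) (n : nat) (J : set {mpoly k[n]}) i :
  is_ideal J -> finite_set [set P | Spec P /\ J `<=` P] ->
  exists2 g : {poly k}, g \is monic & J (map_poly (@mpolyC n k) g).['X_i].
Proof.
move=> idJ finJ; apply: contrapT => noJ.
pose S := [set (map_poly (@mpolyC n k) g).['X_i] | g in [set g | g \is monic]].
have [|||P [specP JP PS]] := @exists_prime_avoiding _ J S idJ.
- by exists 1; rewrite /= ?monic1 // rmorph1 hornerC.
- move=> _ _ [g /= g_mon <-] [h /= h_mon <-].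
  by exists (g * h); rewrite /= ?rpredM // rmorphM hornerM.
- by move=> u Ju [g /= g_mon gu]; apply: noJ; exists g => //; rewrite gu.
have [|g g_mon /residue_map_eq0 Pg] :=
    @Gdomain_mpoly_algebraic k n _ (residue_map specP) i.
  apply: finite_primes_Gdomain; apply: sub_finite_set finJ => Q [specQ PQ].
  by split=> //; apply: subset_trans PQ.
by apply: PS Pg _; exists g.
Qed.

(** * Determinants and Bezoutians modulo an ideal *)

(** The terms at (a, b) and (b, a) combine to c_ab (t_ab - t_ba). *)
Lemma ideal_sum_alternating (R : comNzRingType) (n : nat) (I : set R)
    (c t : 'I_n -> 'I_n -> R) :
  is_ideal I -> (forall a, c a a = 0) -> (forall a b, c a b = - c b a) ->
  (forall a b, I (t a b - t b a)) -> I (\sum_a \sum_b c a b * t a b).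
Proof.
move=> idI c0 cN tI.
pose up := \sum_(a < n) \sum_(b < n | (a < b)%N) c a b * t a b.
pose down := \sum_(a < n) \sum_(b < n | (b < a)%N) c a b * t a b.
have -> : \sum_a \sum_b c a b * t a b = up + down.
  rewrite -big_split; apply: eq_bigr => a _.
  rewrite /= (bigD1 a) //= c0 mul0r add0r.
  rewrite (bigID (fun b : 'I_n => (a < b)%N)) /=.
  congr (_ + _); apply: eq_bigl => b.
    by case: ltngtP => // ab; rewrite ?andbT ?andbF //; apply/eqP => ba;
      rewrite ba ltnn in ab.
  by rewrite -(inj_eq val_inj) -leqNgt andbC /= ltn_neqAle andbC.
have -> : down = \sum_(a < n) \sum_(b < n | (a < b)%N) - (c a b * t b a).
  rewrite /down (exchange_big_dep xpredT) //=; apply: eq_bigr => a _.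
  by apply: eq_bigr => b _; rewrite cN mulNr.
rewrite -big_split; apply: ideal_sum => // a _ /=.
rewrite -big_split; apply: ideal_sum => // b _ /=.
by rewrite -mulrBr; apply: ideal_mull.
Qed.

Section DeterminantIdeal.

Variables (R : comNzRingType) (n : nat) (I : set R).
Hypothesis idI : is_ideal I.
Implicit Types (A B : 'M[R]_n) (z : 'I_n -> R).

Lemma ideal_prodB (J : Type) (r : seq J) (E E' : J -> R) :
  (forall j, I (E j - E' j)) -> I (\prod_(j <- r) E j - \prod_(j <- r) E' j).
Proof.
move=> EE'; elim: r => [|j r IHr].
  by rewrite !big_nil subrr; apply: ideal0.
by rewrite !big_cons; apply: idealBM.
Qed.

Lemma ideal_detB A B : (forall i j, I (A i j - B i j)) -> I (\det A - \det B).
Proof.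
move=> AB; rewrite /determinant -sumrB; apply: ideal_sum => // s _.
by rewrite -mulrBr; apply: ideal_mull => //; apply: ideal_prodB.
Qed.

(* Cramer's rule for A with its i-th row replaced by a unit vector. *)
Lemma ideal_cofactorB A z i a b :
  (forall r, r != i -> I (\sum_l A r l * z l)) ->
  I (z b * cofactor A i a - z a * cofactor A i b).
Proof.
move=> Az.
pose B : 'M[R]_n := \matrix_(r, l) if r == i then (l == a)%:R else A r l.
have cofB l : cofactor B i l = cofactor A i l.
  congr (_ * \det _); apply/matrixP => r s; rewrite !mxE eq_sym.
  by rewrite (negPf (neq_lift _ _)).
have detB : \det B = cofactor A i a.
  rewrite (expand_det_row _ i) (bigD1 a) //= mxE !eqxx mul1r cofB big1 ?addr0 //.
  by move=> l /negPf la; rewrite mxE eqxx la mul0r.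
have Bz r : \sum_l B r l * z l = if r == i then z a else \sum_l A r l * z l.
  case: eqVneq => [->|ri].
    rewrite (bigD1 a) //= mxE !eqxx mul1r big1 ?addr0 // => l /negPf la.
    by rewrite mxE eqxx la mul0r.
  by apply: eq_bigr => l _; rewrite mxE (negPf ri).
have : \sum_l (\adj B *m B) b l * z l = cofactor A i a * z b.
  rewrite mul_adj_mx -detB (bigD1 b) //= mxE eqxx mulr1n big1 ?addr0 // => l.
  by rewrite eq_sym => /negPf lb; rewrite mxE lb mulr0n mul0r.
under eq_bigr do rewrite mxE mulr_suml.
(* In adj(B)(Bz), row [i] contributes [z a] times [cofactor A i b]; every other row contributes an
   element of [I]. *)
rewrite exchange_big (bigD1 i) //=.
have sumB r : \sum_l \adj B b r * B r l * z l = \adj B b r * \sum_l B r l * z l.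
  by rewrite mulr_sumr; apply: eq_bigr => l _; rewrite mulrA.
rewrite sumB Bz eqxx mxE cofB => /esym.
rewrite [z b * _]mulrC [z a * _]mulrC => ->.
rewrite addrAC subrr add0r; apply: ideal_sum => // r ri.
rewrite sumB Bz (negPf ri).
by apply: ideal_mull => //; apply: Az.
Qed.

(** Row [i] is a Koszul combination of [z]. Expanding along it pairs the alternating [c] with z_b
    C_ia, C being the cofactors, which is symmetric in a and b modulo [I]. *)
Lemma ideal_det_alternating_row A z i (c : 'I_n -> 'I_n -> R) :
  (forall r, r != i -> I (\sum_l A r l * z l)) ->
  (forall a, c a a = 0) -> (forall a b, c a b = - c b a) ->
  (forall a, A i a = \sum_b c a b * z b) -> I (\det A).
Proof.
move=> Az c0 cN Ai; rewrite (expand_det_row _ i).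
have -> : \sum_j A i j * cofactor A i j =
    \sum_a \sum_b c a b * (z b * cofactor A i a).
  apply: eq_bigr => a _; rewrite Ai mulr_suml.
  by apply: eq_bigr => b _; rewrite mulrA.
by apply: ideal_sum_alternating => // a b; apply: ideal_cofactorB.
Qed.

Lemma ideal_detB_alternating A B z :
  (forall r, I (\sum_l A r l * z l)) -> (forall r, I (\sum_l B r l * z l)) ->
  (forall r, exists c : 'I_n -> 'I_n -> R,
    [/\ forall a, c a a = 0, forall a b, c a b = - c b a &
        forall a, A r a - B r a = \sum_b c a b * z b]) ->
  I (\det A - \det B).
Proof.
move=> Az Bz AB.
(* The rows of [A] are replaced by those of [B] one at a time; by multilinearity each replacement
   changes the determinant by one having a Koszul row. *)
pose H t : 'M[R]_n := \matrix_(r, l) if (r < t)%N then B r l else A r l.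
have Hz t r : I (\sum_l H t r l * z l).
  by case rt: (r < t)%N; [have := Bz r | have := Az r]; congr (I _);
    apply: eq_bigr => l _; rewrite mxE rt.
have H0 : H 0%N = A by apply/matrixP => r l; rewrite mxE.
have Hn : H n = B by apply/matrixP => r l; rewrite mxE ltn_ord.
rewrite -H0 -Hn.
suff : forall t, (t <= n)%N -> I (\det (H 0%N) - \det (H t)) by apply.
elim=> [_|t IHt lt_tn]; first by rewrite subrr; apply: ideal0.
apply: (idealB_trans idI (IHt (ltnW lt_tn))).
pose i := Ordinal lt_tn.
have [c [c0 cN cE]] := AB i.
pose C : 'M[R]_n := \matrix_(r, l) if r == i then A r l - B r l else H t r l.
have Hi l : H t i l = A i l by rewrite mxE ltnn.
rewrite (@determinant_multilinear _ _ (H t) (H t.+1) C i 1 1).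
- rewrite !mul1r addrC addKr.
  apply: (ideal_det_alternating_row (z := z) (i := i) (c := c)) => //.
    move=> r ri; have := Hz t r.
    by congr (I _); apply: eq_bigr => l _; rewrite [C r l]mxE (negPf ri).
  by move=> a; rewrite mxE eqxx cE.
- apply/rowP => l; rewrite !mxE ltnn ltnSn eqxx !mul1r.
  by rewrite addrCA subrr addr0.
- apply/matrixP => r l; rewrite !mxE ltnS leq_eqVlt.
  by have := neq_lift i r; rewrite -(inj_eq val_inj) eq_sym => /negPf ->.
apply/matrixP => r l; rewrite mxE [RHS]mxE mxE eq_sym.
by rewrite (negPf (neq_lift i r)).
Qed.

End DeterminantIdeal.

(** * Difference quotients and their product rule *)

Section Bezoutian.

Variables (k : fieldType) (n : nat).
Implicit Types (p q : {mpoly k[n]}).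

Definition zvar (j : 'I_n) : {mpoly k[n + n]} := xvar k j - yvar k j.

Definition to_x p : {mpoly k[n + n]} := p \mPo [tuple xvar k j | j < n].
Definition to_y p : {mpoly k[n + n]} := p \mPo [tuple yvar k j | j < n].

Lemma mixed0 : mixed k n 0 = [tuple xvar k j | j < n].
Proof. by apply: eq_from_tnth => l; rewrite !tnth_mktuple. Qed.

Lemma mixedn : mixed k n n = [tuple yvar k j | j < n].
Proof. by apply: eq_from_tnth => l; rewrite !tnth_mktuple ltn_ord. Qed.

Lemma Delta_eq p j D : D * zvar j = Delta_num p j -> Delta p j = D.
Proof. by move=> /eqP; rewrite -DeltaP => /eqP. Qed.

Lemma Delta_mulz p j : Delta p j * zvar j = Delta_num p j.
Proof. by apply/eqP; rewrite -DeltaP. Qed.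

Lemma Delta0 j : Delta (0 : {mpoly k[n]}) j = 0.
Proof. by apply: Delta_eq; rewrite /Delta_num !comp_mpoly0 subrr mul0r. Qed.

Lemma DeltaD p q j : Delta (p + q) j = Delta p j + Delta q j.
Proof.
apply: Delta_eq; move: (Delta_mulz p j) (Delta_mulz q j).
move: (Delta p j) (Delta q j) (zvar j) => P Q z Pz Qz.
rewrite mulrDl Pz Qz /Delta_num !comp_mpolyD.
by rewrite opprD addrACA.
Qed.

(** A Leibniz rule with two different evaluation points, which is where the Koszul correction in
    [Delta_lincomb] comes from. *)
Lemma DeltaM p q j :
  Delta (p * q) j = (p \mPo mixed k n j) * Delta q j
                    + Delta p j * (q \mPo mixed k n j.+1).
Proof.
apply: Delta_eq; move: (Delta_mulz p j) (Delta_mulz q j).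
move: (Delta p j) (Delta q j) (zvar j) => P Q z Pz Qz.
rewrite mulrDl -mulrA Qz mulrAC Pz /Delta_num.
by rewrite !rmorphM /= mulrBr mulrBl addrA subrK.
Qed.

Lemma Delta_sum (J : Type) (r : seq J) (E : J -> {mpoly k[n]}) j :
  Delta (\sum_(i <- r) E i) j = \sum_(i <- r) Delta (E i) j.
Proof.
exact: (big_morph (fun p => Delta p j) (fun p q => DeltaD p q j) (Delta0 j)).
Qed.

Lemma mixedB p a b : (a <= b <= n)%N ->
  (p \mPo mixed k n a) - (p \mPo mixed k n b) =
    \sum_(l < n | (a <= l < b)%N) Delta p l * zvar l.
Proof.
case/andP => le_ab; rewrite -(subnKC le_ab); elim: (b - a)%N => [_|m IHm].
  rewrite addn0 subrr big_pred0 // => l.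
  by apply/negP => /andP[al la]; move: (leq_trans la al); rewrite ltnn.
rewrite addnS => lt_n; pose i := Ordinal lt_n.
rewrite -[LHS](subrKA (p \mPo mixed k n (a + m))) IHm; last exact: ltnW.
rewrite [RHS](bigD1 i) /= ?leq_addr ?ltnSn //.
have -> : (p \mPo mixed k n (a + m)) - (p \mPo mixed k n (a + m).+1) =
  Delta p i * zvar i by exact/esym/Delta_mulz.
rewrite addrC; congr (_ + _); apply: eq_bigl => l.
by rewrite -(inj_eq val_inj) /= ltnS -andbA ltn_neqAle [(l <= _)%N && _]andbC.
Qed.

Lemma to_xyB p : to_x p - to_y p = \sum_l Delta p l * zvar l.
Proof.
rewrite /to_x /to_y -mixed0 -mixedn mixedB ?leqnn //.
by apply: eq_bigl => l; rewrite ltn_ord.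
Qed.

(* The naive product rule, which evaluates every M_j at x and every f_j at y,
   also yields a row of difference quotients; it differs from that of Delta by
   Koszul relations. *)
Lemma Delta_lincomb (M f : 'I_n -> {mpoly k[n]}) :
  exists c : 'I_n -> 'I_n -> {mpoly k[n + n]},
  [/\ forall a, c a a = 0, forall a b, c a b = - c b a &
      forall a, Delta (\sum_j M j * f j) a -
        \sum_j (to_x (M j) * Delta (f j) a + Delta (M j) a * to_y (f j)) =
        \sum_b c a b * zvar b].
Proof.
pose d j (a b : 'I_n) := Delta (M j) a * Delta (f j) b.
pose c (a b : 'I_n) := if (a < b)%N then \sum_j d j a b
              else if (b < a)%N then - \sum_j d j b a else 0.
exists c; split=> [a|a b|a]; first by rewrite /c ltnn.
  by rewrite /c; case: ltngtP => _; rewrite ?opprK ?oppr0.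
rewrite Delta_sum -sumrB.
transitivity (\sum_j \sum_(b < n) (if (a < b)%N then d j a b
              else if (b < a)%N then - d j b a else 0) * zvar b).
  (* Passing from [mixed a] to x in M_j costs the variables of index below [a]; passing from
     [mixed a.+1] to y in f_j costs those above. This gives the two branches of [c]. *)
  apply: eq_bigr => j _; rewrite DeltaM opprD addrACA -mulrBl -mulrBr.
  rewrite /to_x /to_y -mixed0 -mixedn -[_ - (M j \mPo _)]opprB.
  rewrite !mixedB ?leqnn ?ltn_ord //; last by rewrite leq0n ltnW.
  rewrite /d; move: (Delta (M j)) (Delta (f j)) zvar => D1 D2 z.
  rewrite mulNr mulr_suml mulr_sumr -sumrN.
  rewrite big_mkcond [X in _ + X]big_mkcond -big_split.
  apply: eq_bigr => b _ /=.
  rewrite ltn_ord andbT; case: ltngtP => ab; rewrite ?addr0 ?add0r ?mul0r //.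
    by rewrite mulNr mulrAC.
  by rewrite mulrA.
rewrite exchange_big; apply: eq_bigr => b _; rewrite -mulr_suml; congr (_ * _).
rewrite /c; case: ltngtP => // _; first by rewrite sumrN.
by rewrite big1.
Qed.

End Bezoutian.

(** * Residue forms *)

Section LinearExtension.

Variables (k : fieldType) (n : nat) (V : lmodType k) (E : 'X_{1..n} -> V).

Definition mpoly_lift (p : {mpoly k[n]}) : V := \sum_(m <- msupp p) p@_m *: E m.

(** A common bound [d] puts the sums for several polynomials over one index set, as linearity
    requires. *)
Lemma mpoly_liftE d p : (msize p <= d)%N ->
  mpoly_lift p = \sum_(m : 'X_{1..n < d}) p@_m *: E m.
Proof.
move=> le_pd; rewrite /mpoly_lift (big_mksub 'X_{1..n < d}) ?msupp_uniq //=.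
  by rewrite big_rmcond //= => j /memN_msupp_eq0 ->; rewrite scale0r.
by move=> x /msize_mdeg_lt /leq_trans; apply.
Qed.

Lemma mpoly_lift_is_linear : linear mpoly_lift.
Proof.
move=> c p q; pose d := maxn (msize p) (maxn (msize q) (msize (c *: p + q))).
rewrite !(@mpoly_liftE d) ?leq_max ?leqnn ?orbT // scaler_sumr -big_split.
by apply: eq_bigr => m _; rewrite /= mcoeffD mcoeffZ scalerDl scalerA.
Qed.

HB.instance Definition _ :=
  GRing.isLinear.Build k {mpoly k[n]} V _ mpoly_lift mpoly_lift_is_linear.

Lemma mpoly_liftX m : mpoly_lift 'X_[m] = E m.
Proof. by rewrite /mpoly_lift msuppX big_seq1 mcoeffX eqxx scale1r. Qed.

End LinearExtension.

Section UnivariateResidue.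

Variables (k : fieldType) (g : {poly k}).
Hypotheses (g_mon : g \is monic) (g_gt1 : (1 < size g)%N).

(** For monic g this is the coefficient of 1/X in the expansion of X^e / g at infinity;
    [(size g).-2] is deg g - 1. *)
Definition residue (e : nat) : k := ('X^e %% g)`_(size g).-2.

Lemma residue_small e : (e < (size g).-1)%N -> residue e = (e == (size g).-2)%:R.
Proof.
move=> lt_e; rewrite /residue modp_small ?coefXn 1?eq_sym //.
by rewrite size_polyXn -ltn_predRL.
Qed.

Lemma residue_recurrence m : \sum_(t < size g) g`_t * residue (m + t) = 0.
Proof.
have -> : \sum_(t < size g) g`_t * residue (m + t) =
    (('X^m * g) %% g)`_(size g).-2.
  rewrite -[in 'X^m * g](coefK g) poly_def mulr_sumr.
  rewrite (big_morph (fun p => p %% g) (modpD g) (mod0p g)) coef_sum.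
  by apply: eq_bigr => t _; rewrite -scalerAr -exprD modpZl coefZ.
by rewrite modp_mull coef0.
Qed.

End UnivariateResidue.

Section Residue.

Variables (k : fieldType) (n : nat) (rho : 'I_n -> nat -> k).

(* The k[y]-linear form x^a y^b |-> prod_i rho_i(a_i) y^b on k[x, y]. *)
Definition residue_form : {mpoly k[n + n]} -> {mpoly k[n]} :=
  mpoly_lift (fun m => \prod_i (rho i (m (lshift n i)) *: 'X_i ^+ m (rshift n i))).

HB.instance Definition _ := GRing.Linear.on residue_form.

Lemma xymonomE (a b : 'I_n -> nat) :
  \prod_i (xvar k i ^+ a i * yvar k i ^+ b i) = 'X_[ [multinom
    match split j with inl i => a i | inr i => b i end | j < n + n] ].
Proof.
rewrite mpolyXE_id big_split_ord big_split /=; congr (_ * _).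
  by apply: eq_bigr => i _; rewrite mnmE (unsplitK (inl i)).
by apply: eq_bigr => i _; rewrite mnmE (unsplitK (inr i)).
Qed.

Lemma residue_form_xymonom (a b : 'I_n -> nat) :
  residue_form (\prod_i (xvar k i ^+ a i * yvar k i ^+ b i)) =
    \prod_i (rho i (a i) *: 'X_i ^+ b i).
Proof.
rewrite xymonomE /residue_form mpoly_liftX; apply: eq_bigr => i _.
by rewrite !mnmE (unsplitK (inl i)) (unsplitK (inr i)).
Qed.

Lemma xymonom_ind (P : {mpoly k[n + n]} -> Prop) :
  (forall c p q, P p -> P q -> P (c *: p + q)) -> P 0 ->
  (forall a b, P (\prod_i (xvar k i ^+ a i * yvar k i ^+ b i))) ->
  forall p, P p.
Proof.
move=> PD P0 PX; elim/mpolyind => // c m p _ _ Pp; apply: PD => //.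
suff -> : 'X_[m] =
    \prod_i (xvar k i ^+ m (lshift n i) * yvar k i ^+ m (rshift n i)).
  exact: PX.
by rewrite mpolyXE_id big_split_ord big_split.
Qed.

Lemma residue_formM_y p q : residue_form (p * to_y q) = residue_form p * q.
Proof.
elim/xymonom_ind: p => [c p p' IHp IHp'||a b].
- by rewrite mulrDl -scalerAl !linearP /= IHp IHp' mulrDl scalerAl.
- by rewrite mul0r linear0 mul0r.
elim/mpolyind: q => [|c m q _ _ IHq].
  by rewrite /to_y comp_mpoly0 !mulr0 linear0.
rewrite /to_y in IHq *; rewrite comp_mpolyD comp_mpolyZ !mulrDr linearD /= IHq.
congr (_ + _).
rewrite -!scalerAr linearZ; congr (_ *: _) => /=.
rewrite comp_mpolyX -big_split /=.
under eq_bigr do rewrite tnth_mktuple -mulrA -exprD.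
rewrite !residue_form_xymonom [in RHS]mpolyXE_id -big_split.
apply: eq_bigr => i _.
by rewrite /= -scalerAl exprD.
Qed.

(** Without y-variables, every monomial is sent to a product of scalars. *)
Lemma residue_form_x p : exists c, residue_form (to_x p) = c%:MP.
Proof.
elim/mpolyind: p => [|c m p _ _ [d IHp]].
  by exists 0; rewrite /to_x comp_mpoly0 linear0.
exists (c * (\prod_i rho i (m i)) + d).
rewrite /to_x in IHp *; rewrite comp_mpolyD comp_mpolyZ linearP /= IHp mpolyCD.
congr (_ + _).
rewrite mpolyCM mul_mpolyC; congr (_ *: _).
have -> : 'X_[m] \mPo [tuple xvar k j | j < n] =
    \prod_i (xvar k i ^+ m i * yvar k i ^+ (fun=> 0%N) i).
  by rewrite comp_mpolyX; apply: eq_bigr => i _; rewrite tnth_mktuple mulr1.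
rewrite residue_form_xymonom rmorph_prod; apply: eq_bigr => i _.
by rewrite expr0 alg_mpolyC.
Qed.

(** The form is a product over the coordinates, so it can be evaluated factor by factor once
    products are distributed over sums. *)
Lemma residue_form_prod (J : finType) (c : 'I_n -> J -> k)
    (a b : 'I_n -> J -> nat) :
  residue_form
    (\prod_i \sum_j c i j *: (xvar k i ^+ a i j * yvar k i ^+ b i j)) =
    \prod_i \sum_j (c i j * rho i (a i j)) *: 'X_i ^+ b i j.
Proof.
rewrite !bigA_distr_bigA linear_sum; apply: eq_bigr => h _ /=.
rewrite scaler_prod linearZ /= residue_form_xymonom -scaler_prod.
by apply: eq_bigr => i _; rewrite scalerA.
Qed.

End Residue.

(** * Systems with one univariate equation per coordinate *)

Section SeparatedSystem.

Variables (k : fieldType) (n : nat) (g : 'I_n -> {poly k}).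
Hypothesis g_mon : forall i, g i \is monic.
Hypothesis g_gt1 : forall i, (1 < size (g i))%N.

Definition separated : n.-tuple {mpoly k[n]} :=
  [tuple (map_poly (@mpolyC n k) (g i)).['X_i] | i < n].

Local Notation phi := (residue_form (fun i => residue (g i))).

Lemma separatedE i :
  tnth separated i = \sum_(t < size (g i)) (g i)`_t *: 'X_i ^+ t.
Proof.
rewrite tnth_mktuple horner_coef size_map_poly.
by apply: eq_bigr => t _; rewrite coef_map /= mul_mpolyC.
Qed.

Lemma separated_comp m i (s : n.-tuple {mpoly k[m]}) :
  tnth separated i \mPo s = \sum_(t < size (g i)) (g i)`_t *: tnth s i ^+ t.
Proof.
rewrite separatedE linear_sum; apply: eq_bigr => t _.
by rewrite /= comp_mpolyZ rmorphXn /= comp_mpolyXU -tnth_nth.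
Qed.

(** On a monomial, multiplication by g_i(x_i) shifts only the exponent of x_i, and the recurrence
    for the residues of g_i makes that factor vanish. *)
Lemma residue_form_separated i p : phi (to_x (tnth separated i) * p) = 0.
Proof.
elim/xymonom_ind: p => [c p q IHp IHq||a b].
- by rewrite mulrDr -scalerAr linearP /= IHp IHq scaler0 addr0.
- by rewrite mulr0 linear0.
rewrite /to_x separated_comp tnth_mktuple mulr_suml linear_sum /=.
pose rest := \prod_(j < n | j != i) (residue (g j) (a j) *: 'X_j ^+ b j).
transitivity (\sum_(t < size (g i)) ((g i)`_t * residue (g i) (a i + t)) *:
    ('X_i ^+ b i * rest)).
  apply: eq_bigr => t _; rewrite -scalerAl linearZ -scalerA; congr (_ *: _).
  have -> : xvar k i ^+ t * \prod_j (xvar k j ^+ a j * yvar k j ^+ b j) =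
      \prod_j (xvar k j ^+ (a j + (if j == i then t : nat else 0))
               * yvar k j ^+ b j).
    rewrite (bigD1 i) //= [RHS](bigD1 i) //= eqxx exprD !mulrA; congr (_ * _).
      by rewrite [xvar k i ^+ t * _]mulrC.
    by apply: eq_bigr => j /negPf ->; rewrite addn0.
  rewrite [LHS]residue_form_xymonom (bigD1 i) //= eqxx -scalerAl.
  congr (_ *: (_ * _)).
  by apply: eq_bigr => j /negPf ->; rewrite addn0.
by rewrite -scaler_suml residue_recurrence scale0r.
Qed.

Lemma Delta_separated_offdiag i j : j != i -> Delta (tnth separated i) j = 0.
Proof.
move=> ji; apply: Delta_eq.
rewrite mul0r /Delta_num !separated_comp !tnth_mktuple.
have ij : nat_of_ord i != j by rewrite (inj_eq val_inj) eq_sym.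
have -> : (i < j.+1)%N = (i < j)%N by rewrite ltnS leq_eqVlt (negPf ij).
by rewrite subrr.
Qed.

(** The geometric sum for (x^t - y^t)/(x - y), padded with zeros to a square index set so that a
    single index type serves every [i] in [residue_form_prod]. *)
Lemma Delta_separated_diag d i : (size (g i) <= d)%N ->
  Delta (tnth separated i) i = \sum_(te : 'I_d * 'I_d)
    (if (te.2 < te.1)%N then (g i)`_te.1 else 0) *:
      (xvar k i ^+ (te.1.-1 - te.2) * yvar k i ^+ te.2).
Proof.
move=> le_d; apply: Delta_eq.
rewrite /Delta_num !separated_comp !tnth_mktuple ltnn ltnSn.
rewrite -sumrB (big_ord_widen d
  (fun t => (g i)`_t *: xvar k i ^+ t - (g i)`_t *: yvar k i ^+ t)) //.
rewrite [RHS]big_mkcond.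
rewrite -(pair_bigA _ (fun t e : 'I_d => (if (e < t)%N then (g i)`_t else 0) *:
      (xvar k i ^+ (t.-1 - e) * yvar k i ^+ e))) /= mulr_suml.
apply: eq_bigr => t _.
rewrite -scalerBr subrXX; case: ifP => lt_t; last first.
  rewrite big1 ?mul0r // => e _; rewrite nth_default ?if_same ?scale0r //.
  by rewrite leqNgt lt_t.
rewrite (big_ord_widen d (fun e => xvar k i ^+ (t.-1 - e) * yvar k i ^+ e))
  1?ltnW //.
rewrite [zvar k i * _]mulrC scalerAl; congr (_ * _).
rewrite scaler_sumr [RHS]big_mkcond; apply: eq_bigr => e _.
by case: ifP => _; rewrite ?scale0r.
Qed.

Lemma residue_form_Bez_separated : phi (Bez separated) = 1.
Proof.
pose d := \max_i size (g i).
have le_d i : (size (g i) <= d)%N.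
  exact: (leq_bigmax (F := fun i => size (g i))).
have -> : Bez separated = \prod_i Delta (tnth separated i) i.
  rewrite /Bez (_ : \matrix_(i, j) _ =
    diag_mx (\row_i Delta (tnth separated i) i)).
    by rewrite det_diag; apply: eq_bigr => i _; rewrite mxE.
  apply/matrixP => i j; rewrite !mxE.
  case: eqVneq => [->|ij]; first by rewrite mulr1n.
  by rewrite Delta_separated_offdiag // eq_sym.
under eq_bigr do rewrite (Delta_separated_diag (le_d _)).
rewrite [LHS]residue_form_prod big1 // => i _.
have d_gt0 : (0 < d)%N by apply: leq_trans (le_d i); apply: ltnW.
have lt_d : ((size (g i)).-1 < d)%N by move: (le_d i) (g_gt1 i); lia.
(* Only t = deg g_i and e = 0 give the x-exponent deg g_i - 1; all other terms have smaller exponent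
   and residue 0, or coefficient 0. *)
rewrite (bigD1 (Ordinal lt_d, Ordinal d_gt0)) //= big1 ?addr0.
  rewrite ltn_predRL g_gt1 subn0 residue_small; last first.
    by case: size (g_gt1 i) => [|[]].
  by rewrite eqxx mulr1 -lead_coefE (monicP (g_mon i)) scale1r.
move=> [t e] /= te; case: ltnP => lt_et; last by rewrite mul0r scale0r.
have [le_t|lt_t] := leqP (size (g i)) t.
  by rewrite nth_default // mul0r scale0r.
have bound (m p r : nat) : (r < p)%N -> (p < m)%N -> (p.-1 - r < m.-1)%N by lia.
rewrite residue_small; last exact: bound.
case: eqP => [eq_te|_]; last by rewrite mulr0 scale0r.
have extremal (m p r : nat) : (r < p)%N -> (p < m)%N -> (p.-1 - r)%N = m.-2 ->
    (p == m.-1) && (r == 0)%N by lia.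
by case/negP: te; rewrite xpair_eqE -!(inj_eq val_inj) extremal.
Qed.

End SeparatedSystem.

(** * Bezoutians that are constant *)

Lemma ideal_gen_tuple (R : comNzRingType) (n : nat) (s : n.-tuple R) p :
  p \in ideal_gen s -> exists h : 'I_n -> R, p = \sum_j h j * tnth s j.
Proof.
move=> /asboolP[h ->]; exists (h \o cast_ord (esym (size_tuple s))).
rewrite (reindex (cast_ord (size_tuple s))) /=; last first.
  apply: onW_bij; exists (cast_ord (esym (size_tuple s))) => i;
    by rewrite ?cast_ordK ?cast_ordKV.
by apply: eq_bigr => i _; rewrite cast_ordK (tnth_nth 0).
Qed.

Lemma cramer_sum (R : comNzRingType) (n : nat) (A : 'M[R]_n) (v : 'I_n -> R) i :
  \det A * v i = \sum_l \adj A i l * \sum_j A l j * v j.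
Proof.
have := congr1 (fun B => (B *m \col_j v j) i 0) (mul_adj_mx A).
rewrite -mulmxA mul_scalar_mx !mxE => <-.
apply: eq_bigr => l _; congr (_ * _); rewrite mxE.
by apply: eq_bigr => j _; rewrite mxE.
Qed.

Section BezoutianConstant.

Variables (k : fieldType) (n : nat).
Implicit Types (F G : n.-tuple {mpoly k[n]}).

(** The transformation law of Bezoutians. The matrix [A] of G differs from [B] by Koszul rows, and
    [B] differs from [C] by multiples of the F_j(y); both changes preserve the determinant modulo
    [I]. *)
Lemma Bez_lincomb F G (M : 'M[{mpoly k[n]}]_n) (I : set {mpoly k[n + n]}) :
  is_ideal I -> (forall i, tnth G i = \sum_j M i j * tnth F j) ->
  (forall i, I (to_x (tnth G i))) -> (forall j, I (to_y (tnth F j))) ->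
  I (Bez G - to_x (\det M) * Bez F).
Proof.
move=> idI GF Gx Fy.
pose A := \matrix_(i < n, l < n) Delta (tnth G i) l.
pose B := \matrix_(i < n, l < n) \sum_j
  (to_x (M i j) * Delta (tnth F j) l + Delta (M i j) l * to_y (tnth F j)).
pose C := map_mx (@to_x k n) M *m \matrix_(i < n, l < n) Delta (tnth F i) l.
have detC : \det C = to_x (\det M) * Bez F.
  rewrite det_mulmx; congr (_ * _).
  exact: (det_map_mx (comp_mpoly [tuple xvar k j | j < n]) M).
have Gy i : I (to_y (tnth G i)).
  rewrite GF /to_y rmorph_sum; apply: ideal_sum => // j _ /=.
  by rewrite rmorphM; apply: ideal_mull => //; apply: Fy.
have Az i : I (\sum_l A i l * zvar k l).
  under eq_bigr do rewrite mxE.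
  by rewrite -to_xyB; apply: idealB.
have AB i : exists c : 'I_n -> 'I_n -> {mpoly k[n + n]},
    [/\ forall a, c a a = 0, forall a b, c a b = - c b a &
        forall a, A i a - B i a = \sum_b c a b * zvar k b].
  have [c [c0 cN cE]] := Delta_lincomb (fun j => M i j) (tnth F).
  by exists c; split=> // a; rewrite !mxE GF.
have Bz i : I (\sum_l B i l * zvar k l).
  have [c [c0 cN cE]] := AB i.
  have -> : \sum_l B i l * zvar k l =
      \sum_l A i l * zvar k l - \sum_a \sum_b c a b * (zvar k b * zvar k a).
    rewrite -sumrB; apply: eq_bigr => a _.
    under [X in _ - X]eq_bigr do rewrite mulrA.
    by rewrite -mulr_suml -cE -mulrBl opprB addrC subrK.
  apply: idealB => //; apply: ideal_sum_alternating => // a b.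
  by rewrite mulrC subrr; apply: ideal0.
apply: (idealB_trans idI (v := \det B)).
  exact: (ideal_detB_alternating idI Az Bz AB).
rewrite -detC; apply: ideal_detB => // i l.
rewrite !mxE -sumrB; apply: ideal_sum => // j _; rewrite !mxE.
by rewrite addrAC subrr add0r; apply: ideal_mull.
Qed.

Lemma constant_mod_ideal F (g : 'I_n -> {poly k}) (c : k) :
  (forall i, g i \is monic) -> (forall i, (1 < size (g i))%N) ->
  (forall i, tnth (separated g) i \in ideal_gen F) ->
  Bez F - c%:MP \in ideal_gen (at_x F ++ at_y F) ->
  forall a, exists s : k, a - s%:MP \in ideal_gen F.
Proof.
move=> g_mon g_gt1 gF BezF a.
pose phi := residue_form (fun i => residue (g i)).
have idJ := ideal_gen_ideal F.
(* [K] is the largest ideal that [phi] maps into (F). It contains F(y) by k[y]-linearity and G(x)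
   because [phi] kills it. *)
pose K : set {mpoly k[n + n]} := [set p | forall r, phi (p * r) \in ideal_gen F].
have idK : is_ideal K.
  split=> [r|u p q Kp Kq r]; first by rewrite mul0r /phi linear0 rpred0.
  by rewrite mulrDl [u * p]mulrC -mulrA /phi linearD rpredD.
have Fy j : K (to_y (tnth F j)).
  move=> r; rewrite /phi mulrC residue_formM_y.
  by apply: (ideal_mull idJ); apply: ideal_gen_mem; apply: mem_tnth.
have Gx i : K (to_x (tnth (separated g) i)).
  by move=> r; rewrite /phi residue_form_separated // rpred0.
have [h hE] := choice (fun i => ideal_gen_tuple (gF i)).
pose M : 'M[{mpoly k[n]}]_n := \matrix_(i, j) h i j.
have GF i : tnth (separated g) i = \sum_j M i j * tnth F j.
  by rewrite hE; apply: eq_bigr => j _; rewrite mxE.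
have detF i : K (to_x (\det M) * to_x (tnth F i)).
  rewrite /to_x -rmorphM (cramer_sum M (tnth F)) rmorph_sum.
  apply: (ideal_sum idK) => // l _; rewrite /= rmorphM -GF.
  by apply: (ideal_mull idK); apply: Gx.
have Gy i : K (to_y (tnth (separated g) i)).
  rewrite GF /to_y rmorph_sum; apply: (ideal_sum idK) => // j _ /=.
  by rewrite rmorphM; apply: (ideal_mull idK); apply: Fy.
(* Multiplication by det M(x) carries all of (F(x), F(y)) into [K], so the assumption on Bez(F) can
   be used there. *)
have KBezF : K (to_x (\det M) * Bez F - to_x (\det M) * c%:MP).
  rewrite -mulrBr.
  apply: (@ideal_gen_min _ _ [set p | K (to_x (\det M) * p)] _ _ _ BezF).
    split=> [|u p q Kp Kq] /=; first by rewrite mulr0; apply: (ideal0 idK).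
    by rewrite mulrDr mulrCA; apply: idK.2.
  move=> p; rewrite mem_cat => /orP[] /tnthP[i ->]; rewrite tnth_mktuple.
    exact: detF.
  by apply: (ideal_mull idK); apply: Fy.
have BezG : K (Bez (separated g) - to_x (\det M) * c%:MP).
  by apply: (idealB_trans idK _ KBezF); apply: Bez_lincomb.
(* By Cramer, Bez(G) (x_j - y_j) is a combination of the G_l(x) - G_l(y). *)
have zBez j : K (Bez (separated g) * zvar k j).
  rewrite /Bez cramer_sum; apply: (ideal_sum idK) => // l _.
  apply: (ideal_mull idK).
  by under eq_bigr do rewrite mxE; rewrite -to_xyB; apply: (idealB idK).
have aBez : K (Bez (separated g) * to_y a - to_x (a * \det M) * c%:MP).
  apply: (idealB_trans idK (v := to_x a * Bez (separated g))).
    apply: (idealB_sym idK); rewrite [to_x a * _]mulrC -mulrBr to_xyB mulr_sumr.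
    apply: (ideal_sum idK) => // j _; rewrite mulrCA.
    exact: (ideal_mull idK).
  rewrite {2}/to_x rmorphM -mulrA -mulrBr; exact: (ideal_mull idK).
have [s sE] := residue_form_x (fun i => residue (g i)) (a * \det M).
(* Applying [phi] itself sends a(y) Bez(G) to [a] and c a(x) det M(x) to the scalar [s * c]. *)
exists (s * c); have := aBez 1.
rewrite mulr1 /phi linearB /= residue_formM_y residue_form_Bez_separated // mul1r.
by rewrite mulrC mul_mpolyC linearZ /= sE -mul_mpolyC -mpolyCM mulrC.
Qed.

End BezoutianConstant.

(** * Fibers over rational points and the conclusion *)

Lemma is_constantP (k : fieldType) (m : nat) (s : seq {mpoly k[m]})
    (p : {mpoly k[m]}) :
  is_constant (\pi_{ideal_quot (ideal_gen s)} p) ->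
  exists c : k, p - c%:MP \in ideal_gen s.
Proof.
move=> [[_ [c /eqP]]|[_ /eqP]]; first by rewrite -Quotient.idealrBE; exists c.
rewrite -[0](raddf0 \pi_{ideal_quot (ideal_gen s)}) -Quotient.idealrBE => p0.
by exists 0; rewrite mpolyC0.
Qed.

Lemma fiber_atE (k : fieldType) (n : nat)
    (f : n.-tuple {mpoly k[n]}) (q : n.-tuple k) :
  fiber_at f q =
    [set P | Spec P /\ [set p | p \in ideal_gen (mor_sub f q)] `<=` P].
Proof.
apply/seteqP; split=> P [specP PF]; split=> //.
  have [idP _ _] := (SpecP P).1 specP.
  by apply: ideal_gen_min => // p /tnthP[i ->].
by move=> i; apply: PF; apply: ideal_gen_mem; apply: mem_tnth.
Qed.

(** Modulo [P] each f_i equals q_i, hence g(f) equals g(q); so [P] contracts to the maximal ideal of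
    [q]. This lets the finiteness hypothesis apply to [fiber_at]. *)
Lemma fiber_at_sub_fiber_over (k : fieldType) (n : nat)
    (f : n.-tuple {mpoly k[n]}) (q : n.-tuple k) :
  fiber_at f q `<=` fiber_over f [set g | g.@[tnth q] = 0].
Proof.
move=> P [specP Pf]; split=> //; have [idP P1 _] := (SpecP P).1 specP.
have Pg g : P (g \mPo f - (g.@[tnth q])%:MP).
  elim/mpolyind: g => [|c m g _ _ Pg].
    by rewrite comp_mpoly0 meval0 mpolyC0 subrr; apply: ideal0.
  rewrite comp_mpolyD comp_mpolyZ mevalD mevalZ mpolyCD mpolyCM mul_mpolyC.
  rewrite opprD addrACA -scalerBr; apply: idealD => //.
  rewrite -mul_mpolyC; apply: ideal_mull => //.
  rewrite comp_mpolyX mevalX rmorph_prod; apply: ideal_prodB => // i /=.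
  rewrite rmorphXn /=; elim: (m i) => [|e IHe].
    by rewrite !expr0 subrr; apply: ideal0.
  rewrite !exprS; apply: idealBM => //.
  by have := Pf i; rewrite tnth_mktuple.
apply/seteqP; split=> g /=.
  move=> Pgf; apply: contrapT => /eqP gq; apply: P1.
  have := ideal_mull idP (g.@[tnth q])^-1%:MP (idealB idP Pgf (Pg g)).
  by rewrite opprB addrCA subrr addr0 -mpolyCM mulVf.
by move=> gq; have := Pg g; rewrite gq mpolyC0 subr0.
Qed.

Lemma Spec_point (k : fieldType) (n : nat) (v : 'I_n -> k) :
  Spec [set g : {mpoly k[n]} | g.@[v] = 0].
Proof.
apply/SpecP; split=> [||p q].
- split=> [|a p q] /=; first by rewrite meval0.
  by move=> p0 q0; rewrite mevalD mevalM p0 q0 mulr0 addr0.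
- by rewrite /= meval1 => /eqP; rewrite oner_eq0.
by rewrite /= mevalM => /eqP; rewrite mulf_eq0 => /orP[]/eqP; [left|right].
Qed.

Theorem theorem1p3 (k : fieldType) (n : nat)
    (f : n.-tuple {mpoly k[n]}) (q : n.-tuple k) :
  has_finite_fibers f ->
  is_constant (reduced_Bez (mor_sub f q)) ->
  (fiber_at f q #<= `I_1)%card.
Proof.
move=> fin_f /is_constantP[c BezF].
have fin_fiber : finite_set (fiber_at f q).
  apply: sub_finite_set (fin_f _ (Spec_point (tnth q))).
  exact: fiber_at_sub_fiber_over.
set F := mor_sub f q in BezF; rewrite fiber_atE -/F in fin_fiber *.
have idF := ideal_gen_ideal F.
have ex_g i : exists g : {poly k}, [/\ g \is monic, (1 < size g)%N &
    (map_poly (@mpolyC n k) g).['X_i] \in ideal_gen F].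
  have [g g_mon gF] := finite_primes_elimination i idF fin_fiber.
  (* The factor X forces positive degree: [g] may be 1 when the ideal is improper. *)
  exists ('X * g); rewrite monicMl ?monicX //.
  rewrite size_mul ?polyX_eq0 ?monic_neq0 // size_polyX.
  split=> //; first by rewrite /= ltnS size_poly_gt0 monic_neq0.
  by rewrite rmorphM hornerM; apply: (ideal_mull idF).
have [g gP] := choice ex_g.
have constF a : exists s : k, a - s%:MP \in ideal_gen F.
  apply: (@constant_mod_ideal k n F g c) => [i|i|i|//];
    have [g_mon g_gt1 gF] := gP i => //.
  by rewrite tnth_mktuple.
(* If [a] in [P] is congruent to a scalar [s], then [s] lies in [P], hence is 0, and [a] lies in
   (F), so in [Q]. *)
have subP P Q : Spec P -> [set p | p \in ideal_gen F] `<=` P ->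
    Spec Q -> [set p | p \in ideal_gen F] `<=` Q -> P `<=` Q.
  move=> specP FP specQ FQ a Pa.
  have [idP P1 _] := (SpecP P).1 specP.
  have [s aF] := constF a; have [s0|s0] := eqVneq s 0.
    by move: aF; rewrite s0 mpolyC0 subr0 => /FQ.
  case: P1; have := ideal_mull idP s^-1%:MP (idealB idP Pa (FP _ aF)).
  by rewrite opprB addrCA subrr addr0 -mpolyCM mulVf.
have [[P [sP FP]]|noP] :=
    pselect (exists P, Spec P /\ [set p | p \in ideal_gen F] `<=` P).
  apply: (@card_le_trans _ _ _ [set P]).
    by apply: subset_card_le => Q [sQ FQ]; apply/seteqP; split; apply: subP.
  by rewrite (card_le_eql card_set1).
have -> : [set P | Spec P /\ [set p | p \in ideal_gen F] `<=` P] = set0.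
  by apply/seteqP; split=> // P PF; apply: noP; exists P.
exact: card_ge0.
Qed.
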